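(* Let $G=(V,E)$ be a finite, simple, undirected graph and $s,t\in V$ with $s$ and $t$ connected in $G$. The procedure LIST described below, started with the call $\mathrm{LIST}(s, s, \pi, G)$ for an arbitrary $st$-path $\pi$ of $G$, correctly outputs all chordless $st$-paths of $G$ (every chordless $st$-path of $G$ is output, and every output path is a chordless $st$-path of $G$).
   Context: A path is chordless if the subgraph of $G$ induced by its vertices contains exactly the edges of the path. $N_H(u)$ denotes the neighbourhood of $u$ in the current graph $H$. The procedure $\mathrm{LIST}(\pi_{su}, u, \pi_{ut}, H)$ takes a path $\pi_{su}$ from $s$ to $u$, the current vertex $u$, a $u$–$t$ path $\pi_{ut}$ in $H$, and a current graph $H$ (a graph obtained from $G$ by deleting some vertices with their incident edges; it is modified in place). It works as follows. If $u=t$, output $\pi_{su}$. Otherwise set $S:=\emptyset$ and repeat: let $v$ be the vertex of $N_H(u)$ lying on $\pi_{ut}$ that is closest to $t$ along $\pi_{ut}$; let $\pi_{vt}$ be the subpath of $\pi_{ut}$ from $v$ to $t$; add the pair $(v,\pi_{vt})$ to $S$; delete $v$ and its incident edges from $H$; if $u$ and $t$ are not connected in $H$, leave the loop; otherwise set $\pi_{ut}$ to be any $u$–$t$ path in $H$ and continue. After the loop, for each pair $(v,\pi_{vt})\in S$ in turn: add $v$ and its incident edges back to $H$, call $\mathrm{LIST}(\pi_{su}\cdot(u,v), v, \pi_{vt}, H)$, and then delete $v$ and its incident edges from $H$ again. Here $\pi_{su}\cdot(u,v)$ is the path $\pi_{su}$ extended by the edge $(u,v)$.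
   Formalization: H is restored to its state at the call when a recursive call of LIST returns (each call works on its own copy of H); if the callee's deletions persisted in place, the claim would fail on the 4-cycle s,a,t,b, where t stays deleted after the call for a. *)

(* Defs.v *)
From mathcomp Require Import all_boot.
From Stdlib Require Import Relations.

Set Implicit Arguments.
Unset Strict Implicit.
Unset Printing Implicit Defensive.

(* A graph G on V is given by its adjacency relation e.  A graph obtained     *)
(* from G by deleting vertices with their incident edges is an induced        *)
(* subgraph, so it is encoded by the set H of its remaining vertices:         *)
(* deleting v is H :\ v, and putting v back with its edges is v |: H.         *)

Definition nbhd (V : finType) (e : rel V) (H : {set V}) (u : V) : {set V} :=
  [set v in H | e u v].

Definition connected (V : finType) (e : rel V) (H : {set V}) (x y : V) : bool :=
  [&& x \in H, y \in H &
      connect [rel a b | [&& a \in H, b \in H & e a b]] x y].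

(* Paths are vertex sequences without repetition, both endpoints included.    *)
Definition path_in (V : finType) (e : rel V) (H : {set V}) (x y : V)
    (p : seq V) : bool :=
  if p is z :: q then
    [&& z == x, path e z q, last z q == y, uniq p & all [in H] p]
  else false.

Definition path_edge (V : finType) (p : seq V) (a b : V) : bool :=
  ((a, b) \in zip p (behead p)) || ((b, a) \in zip p (behead p)).

Definition chordless (V : finType) (e : rel V) (p : seq V) : Prop :=
  {in p &, forall a b, e a b = path_edge p a b}.

Definition chordless_path (V : finType) (e : rel V) (s t : V) (p : seq V) :
    Prop :=
  path_in e [set: V] s t p /\ chordless e p.

(* v is the vertex of N_H(u) on put closest to its end, and pvt is the        *)
(* subpath of put that starts at v.                                           *)
Definition closest_nbr (V : finType) (e : rel V) (H : {set V}) (u : V)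
    (put : seq V) (v : V) (pvt : seq V) : Prop :=
  exists r1 r2, [/\ put = r1 ++ v :: r2, pvt = v :: r2,
    v \in nbhd e H u & {in r2, forall w, w \notin nbhd e H u}].

(* LIST is given as a small-step abstract machine, nondeterministic in the    *)
(* choice of each new u-t path and in the order in which S is traversed.      *)
(* A frame is an activation of LIST that is                                   *)
(*   - about to start (Call),                                                 *)
(*   - at the start of an iteration of the loop collecting S (Search), or     *)
(*   - traversing S, with S the pairs not yet treated (Visit).                *)
(* Each activation owns its current graph H, so a caller that is resumed      *)
(* finds H as it was at the call.  If the deletions made by the callee were   *)
(* still in force, its neighbours on the way to t, possibly t itself, would   *)
(* be missing and the next call would not receive a path of H.                *)
Inductive frame (V : finType) : Type :=
| Call (psu : seq V) (u : V) (put : seq V) (H : {set V})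
| Search (psu : seq V) (u : V) (put : seq V) (H : {set V})
    (S : seq (V * seq V))
| Visit (psu : seq V) (u : V) (H : {set V}) (S : seq (V * seq V)).

(* The stack of activations, innermost first, and the paths output so far.    *)
Definition config (V : finType) : Type := (seq (frame V) * seq (seq V))%type.

Inductive step (V : finType) (e : rel V) (t : V) :
    config V -> config V -> Prop :=
| step_output psu put H k out :
    step e t (Call psu t put H :: k, out) (k, rcons out psu)
| step_start psu u put H k out :
    u <> t ->
    step e t (Call psu u put H :: k, out) (Search psu u put H [::] :: k, out)
| step_leave psu u put H S v pvt k out :
    closest_nbr e H u put v pvt ->
    ~~ connected e (H :\ v) u t ->
    step e t (Search psu u put H S :: k, out)
             (Visit psu u (H :\ v) (rcons S (v, pvt)) :: k, out)
| step_continue psu u put H S v pvt put' k out :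
    closest_nbr e H u put v pvt ->
    connected e (H :\ v) u t ->
    path_in e (H :\ v) u t put' ->
    step e t (Search psu u put H S :: k, out)
             (Search psu u put' (H :\ v) (rcons S (v, pvt)) :: k, out)
| step_visit psu u H S1 S2 v pvt k out :
    step e t (Visit psu u H (S1 ++ (v, pvt) :: S2) :: k, out)
             (Call (rcons psu v) v pvt (v |: H)
                :: Visit psu u ((v |: H) :\ v) (S1 ++ S2) :: k, out)
| step_return psu u H k out :
    step e t (Visit psu u H [::] :: k, out) (k, out).

Definition initial (V : finType) (s : V) (pi : seq V) : config V :=
  ([:: Call [:: s] s pi [set: V]], [::]).

Definition terminates (V : finType) (e : rel V) (t : V) (c : config V) : Prop :=
  Acc (fun c2 c1 => step e t c1 c2) c.

(* c' need not have an empty stack: blocked configurations are included.      *)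
Definition halts_in (V : finType) (e : rel V) (t : V) (c c' : config V) :
    Prop :=
  clos_refl_trans _ (step e t) c c' /\ forall c2, ~ step e t c' c2.

(* Main.v *)
(* Let H be the graph when the loop for u stops, the vertices v of S having   *)
(* been deleted from the initial graph H0.  Since u and t are disconnected in *)
(* H, the tail of a v-t path in H + v avoids u and all its neighbours, so     *)
(* that u followed by a chordless v-t path of H + v is a chordless u-t path   *)
(* of H0.  Conversely the second vertex of a chordless u-t path of H0 must    *)
(* belong to S, as otherwise the path would survive in H.  Prefixing by u     *)
(* also shows that the longest v-t path of H + v is shorter than the longest  *)
(* u-t path of H0, which bounds the depth of the recursion.                   *)

Require Import Defs.
From Stdlib Require Import Relations Setoid.
From mathcomp Require Import all_boot.

Set Implicit Arguments.
Unset Strict Implicit.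
Unset Printing Implicit Defensive.

(** Consider one activation with current vertex [u] and initial graph [H0]. Its loop splits [H0]
    into the final graph [H] and the stored neighbours of [u]. By [chordless_in_branch], the
    chordless u-t paths of [H0] are then exactly [u] followed by a chordless v-t path of [v |: H],
    over all stored [v], so the recursive calls jointly produce the right set in whatever order they
    are made. For the machine, [emits] describes the contribution of one activation in continuation
    form. [emits_visit], [emits_search] and [emits_call] establish it by inductions on the number of
    pending pairs, on [#|H|], and on a bound for the u-t paths. [inevitable] carries termination and
    correctness of all runs at once. *)

Section Paths.

Variables (V : finType) (e : rel V).
Implicit Types (H : {set V}) (p q r : seq V).

(** * Paths and connectivity in induced subgraphs *)

Lemma path_inP H x y p :
  reflect (exists r, [/\ p = x :: r, path e x r, last x r = y,
                         uniq (x :: r) & {subset x :: r <= H}])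
          (path_in e H x y p).
Proof.
case: p => [|z q]; first by right=> -[r []].
apply: (iffP and5P) => [[/eqP-> ? /eqP ? ? sH]|[r [[-> ->] ? <- ? sH]]].
  by exists q; split=> //; apply/allP.
by split=> //; apply/allP.
Qed.

Lemma walk_connected H x r :
  x \in H -> path e x r -> {subset r <= H} -> connected e H x (last x r).
Proof.
move=> xH er rH; apply/and3P; split=> //.
  by case/lastP: r {er} rH => // r z rH; rewrite last_rcons rH // mem_rcons mem_head.
apply/connectP; exists r => //.
elim: r x xH er rH => //= z r IHr x xH /andP[exz ezr] rH.
have zH : z \in H by apply: rH; apply: mem_head.
by rewrite xH zH exz IHr // => w wr; apply: rH; rewrite inE wr orbT.
Qed.

Lemma connected_path_in H x y :
  connected e H x y -> exists p, path_in e H x y p.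
Proof.
case/and3P=> xH yH /connectP[r er ->].
case/shortenP: er => q eq uq _; exists (x :: q); apply/path_inP; exists q.
split=> //; first by apply: sub_path eq => a b /and3P[].
elim: q x xH eq {uq} => [|z q IHq] x xH /=; first by move=> _ w /[!inE] /eqP->.
case/andP=> /and3P[_ zH _] eq w /[1!inE] /predU1P[-> //|]; exact: IHq.
Qed.

(** Keeps the loop from blocking: the second vertex of the path is a neighbour of [x], so there is a
    last one. *)
Lemma closest_nbr_exists H x y p :
  x <> y -> path_in e H x y p -> exists v pvt, closest_nbr e H x p v pvt.
Proof.
move=> nxy /path_inP[r [-> er lr _ rH]].
suff [r1 [v [r2 [-> vN r2N]]]] : exists r1 v r2,
    [/\ x :: r = r1 ++ v :: r2, v \in nbhd e H x
      & {in r2, forall w, w \notin nbhd e H x}].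
  by exists v, (v :: r2), r1, r2.
have : has [in nbhd e H x] (x :: r).
  case: r er lr rH => [_ /nxy //|z r /andP[exz _] _ rH].
  apply/hasP; exists z; rewrite ?inE ?eqxx ?orbT //=.
  by rewrite exz rH // !inE eqxx orbT.
elim: (x :: r) => //= z q IHq.
have [/IHq[r1 [v [r2 [-> vN r2N]]]] _|/hasPn qN] := boolP (has _ q).
  by exists (z :: r1), v, r2.
by rewrite orbF => zN; exists [::], z, q.
Qed.

(** * Path edges and chordless paths *)

Lemma path_edge_mem p a b : path_edge p a b -> (a \in p) && (b \in p).
Proof.
have zip_mem c d : (c, d) \in zip p (behead p) -> (c \in p) && (d \in p).
  case: p => // x q; elim: q x => //= y q IHq x.
  rewrite [in X in X -> _]inE => /predU1P[[-> ->]|/IHq /andP[cq dq]].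
    by rewrite !inE !eqxx orbT.
  by rewrite inE cq orbT inE dq orbT.
by case/orP=> /zip_mem // /andP[-> ->].
Qed.

Lemma path_edge_cons x y r a b :
  path_edge [:: x, y & r] a b =
  [|| (a == x) && (b == y), (b == x) && (a == y) | path_edge (y :: r) a b].
Proof. by rewrite /path_edge /= !inE !xpair_eqE -!orbA; do !bool_congr. Qed.

Hypotheses (e_sym : symmetric e) (e_irr : irreflexive e).

Lemma chordless1 x : chordless e [:: x].
Proof. by move=> a b /[!inE] /eqP-> /eqP->; rewrite e_irr. Qed.

(** Since [x] does not recur, xy is the only path edge at [x]; all other pairs are judged by the
    tail alone. *)
Lemma chordless_cons x y r : x \notin y :: r -> y \notin r ->
  chordless e [:: x, y & r] <->
  [/\ e x y, {in r, forall w, ~~ e x w} & chordless e (y :: r)].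
Proof.
move=> xr yr; have nedge b : path_edge (y :: r) x b = false.
  by apply: contraNF xr => /path_edge_mem /andP[].
have nedge' b : path_edge (y :: r) b x = false.
  by apply: contraNF xr => /path_edge_mem /andP[].
have nx a : a \in y :: r -> (a == x) = false.
  by move=> ar; apply: contraNF xr => /eqP<-.
split=> [cp|[exy xN cp] a b].
  have exE w : w \in y :: r -> e x w = (w == y).
    move=> wr; rewrite cp ?mem_head ?inE ?[(w == y) || _]wr ?orbT //.
    by rewrite path_edge_cons eqxx nedge (nx w wr) /= orbF.
  split=> [|w wr|a b ar br]; first by rewrite exE ?mem_head.
    by rewrite exE ?inE ?wr ?orbT //; apply: contraNneq yr => <-.
  rewrite cp ?[_ \in x :: _]inE ?ar ?br ?orbT //.
  by rewrite path_edge_cons !nx.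
have exE w : w \in y :: r -> e x w = (w == y).
  by case/predU1P=> [->|wr]; rewrite ?eqxx // (negPf (xN w wr));
    apply/esym; apply: contraNF yr => /eqP<-.
rewrite path_edge_cons ![_ \in x :: _]inE.
case/predU1P=> [->|ar]; case/predU1P=> [->|br].
- by rewrite eqxx e_irr nedge; rewrite inE negb_or in xr; case/andP: xr => /negPf->.
- by rewrite eqxx nedge nx //= orbF exE.
- by rewrite eqxx nedge' nx //= orbF e_sym exE.
- by rewrite !nx //= cp.
Qed.

Definition chordless_in H x y p := path_in e H x y p /\ chordless e p.

(** * Branching at one vertex *)

Section Branching.

(* H is the graph left by the loop for u, and D the set of deleted vertices.  *)
Variables (H D : {set V}) (u t : V).
Hypotheses (uH : u \in H) (eD : {in D, forall v, e u v})
  (sep : ~~ connected e H u t).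

(** If [r] met [u] or a neighbour of [u], its remainder from there would join [u] to [t] inside [H],
    against [sep]. *)
Lemma tail_avoids v r : v \in D -> path_in e (v |: H) v t (v :: r) ->
  {in r, forall w, (w != u) && ~~ e u w} /\ {subset r <= H}.
Proof.
move=> vD /path_inP[_ [[<-] er lr /= /andP[vr _] rH]].
have {}rH : {subset r <= H}.
  move=> w wr; have := rH w; rewrite !inE wr orbT => /(_ isT) /predU1P[wv|//].
  by rewrite -wv wr in vr.
split=> // w wr; apply/andP; split; apply: contraNN sep => ew.
  case/splitPr: wr er lr rH => r1 r2; rewrite cat_path last_cat /= (eqP ew).
  case/and3P=> _ _ er <- rH; apply: walk_connected => // z zr.
  by apply: rH; rewrite mem_cat inE zr !orbT.
case/splitPr: wr er lr rH => r1 r2; rewrite cat_path last_cat /=.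
case/and3P=> _ _ er <- rH; apply: (@walk_connected _ u (w :: r2)) => //=.
  by rewrite ew.
by move=> z zr; apply: rH; rewrite mem_cat zr orbT.
Qed.

Lemma path_in_cons v q : v \in D -> path_in e (v |: H) v t q ->
  path_in e (H :|: D) u t (u :: q).
Proof.
move=> vD pq; have := pq; case/path_inP=> r [qE er lr uq _].
rewrite {q}qE in pq *; have [av rH] := tail_avoids vD pq.
apply/path_inP; exists (v :: r); split=> //; first by rewrite /= eD.
  rewrite cons_uniq uq andbT inE negb_or; apply/andP; split.
    by apply: contraTneq (eD vD) => <-; rewrite e_irr.
  by apply/negP=> ur; have /andP[] := av u ur; rewrite eqxx.
move=> w; rewrite !inE => /or3P[/eqP->|/eqP->|/rH->] //; first by rewrite uH.
by rewrite vD orbT.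
Qed.

Lemma chordless_in_branch q : u != t ->
  chordless_in (H :|: D) u t q <->
  exists v q', [/\ v \in D, chordless_in (v |: H) v t q' & q = u :: q'].
Proof.
move=> nut; split=> [[/path_inP[[|v r] [-> er lr uq qH]] cq]|].
- by rewrite -lr eqxx in nut.
- have /= /and3P[ur vr uqr] := uq.
  have [euv nur cr] := (chordless_cons ur vr).1 cq.
  case/andP: er => _ er.
  (* By chordlessness [r] contains no neighbour of [u], whereas [D] consists of neighbours. *)
  have rH : {subset r <= H}.
    move=> w wr; have := qH w; rewrite !inE wr !orbT => /(_ isT) /orP[//|/eD].
    by rewrite (negPf (nur w wr)).
  (* Otherwise the whole path would survive in [H]. *)
  have vD : v \in D.
    have := qH v; rewrite !inE eqxx orbT => /(_ isT) /orP[vH|//].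
    case/negP: sep; rewrite -lr; apply: walk_connected => //=.
      by rewrite euv.
    by move=> w /predU1P[->|/rH].
  exists v, (v :: r); split=> //; split=> //; apply/path_inP; exists r.
  split=> //; first by rewrite /= vr.
  by move=> w /predU1P[->|/rH wH]; rewrite !inE ?eqxx ?wH ?orbT.
- case=> v [q' [vD [pq cq] ->]]; have := path_in_cons vD pq.
  split=> //; have := pq; case/path_inP=> r [q'E _ _ _ _]; subst q'.
  have [av _] := tail_avoids vD pq.
  case/path_inP: (path_in_cons vD pq) => _ [[<-] _ _ /= /and3P[ur vr _] _].
  apply/(chordless_cons ur vr); split=> //; first exact: eD.
  by move=> w wr; have /andP[] := av w wr.
Qed.

End Branching.

Lemma chordless_in_refl H t q : t \in H -> chordless_in H t t q <-> q = [:: t].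
Proof.
move=> tH; split=> [[/path_inP[r [-> _ lr tr _]] _]|->].
  case: r lr tr => //= z r lr /andP[].
  by rewrite -{1}lr mem_last.
split; last exact: chordless1.
by apply/path_inP; exists [::]; split=> // w /[!inE] /eqP->.
Qed.

End Paths.

(** * Runs of the machine *)

Section Runs.

Variables (V : finType) (e : rel V) (t : V).
Hypotheses (e_sym : symmetric e) (e_irr : irreflexive e).

Lemma step_visitE psu u H S k out c :
  step e t (Visit psu u H S :: k, out) c ->
  S = [::] /\ c = (k, out) \/
  exists S1 S2 v pvt, S = S1 ++ (v, pvt) :: S2 /\
    c = (Call (rcons psu v) v pvt (v |: H)
           :: Visit psu u ((v |: H) :\ v) (S1 ++ S2) :: k, out).
Proof.
by move=> st; inversion st; subst; [right; exists S1, S2, v, pvt | left].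
Qed.

Lemma step_searchE psu u put H S k out c :
  step e t (Search psu u put H S :: k, out) c ->
  exists v pvt, closest_nbr e H u put v pvt /\
    (~~ connected e (H :\ v) u t /\
       c = (Visit psu u (H :\ v) (rcons S (v, pvt)) :: k, out) \/
     exists put', path_in e (H :\ v) u t put' /\
       c = (Search psu u put' (H :\ v) (rcons S (v, pvt)) :: k, out)).
Proof.
by move=> st; inversion st; subst; exists v, pvt; split=> //;
  [left | right; exists put'].
Qed.

(** Being inductive excludes infinite runs that avoid [P]; demanding a successor excludes blocked
    configurations outside [P]. *)
Inductive inevitable (P : config V -> Prop) (c : config V) : Prop :=
| inevitable_now of P c
| inevitable_later of (exists c', step e t c c')
    & (forall c', step e t c c' -> inevitable P c').

Lemma inevitable_halts (P : config V -> Prop) c :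
  (forall c1 c2, P c1 -> ~ step e t c1 c2) -> inevitable P c ->
  terminates e t c /\ (forall c', halts_in e t c c' -> P c').
Proof.
move=> stuck; elim=> {c} [c Pc|c [c1 cc1] _ IH]; split.
- by constructor=> c2 /(stuck _ _ Pc).
- move=> c' [/clos_rt_rt1n_iff cc' _].
  by case: cc' Pc => // c1 c2 cc1 _ /stuck /(_ cc1).
- by constructor=> c2 /IH[].
- move=> c' [/clos_rt_rt1n_iff cc' hc'].
  case: cc' cc1 IH hc' => [cc1 _ /(_ _ cc1) //|c2 c3 cc2 c23 _ IH hc3].
  by have [_ ] := IH _ cc2; apply; split=> //; apply/clos_rt_rt1n_iff.
Qed.

(** * The output of one activation *)

Variable P : config V -> Prop.

(* Once the activation fr on top of the stack is popped, exactly the paths    *)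
(* satisfying Q have been added to the output.                                *)
Definition emits (fr : frame V) (Q : seq V -> Prop) : Prop :=
  forall k out,
    (forall out', (forall p, p \in out' <-> p \in out \/ Q p) ->
       inevitable P (k, out')) ->
    inevitable P (fr :: k, out).

(** The bound [n] is the induction measure for the recursion. In a run [psu] already ends in [u],
    hence [behead]. *)
Definition call_spec n := forall psu u put H,
  (forall q, path_in e H u t q -> size q <= n) -> path_in e H u t put ->
  emits (Call psu u put H)
    (fun p => exists q, chordless_in e H u t q /\ p = psu ++ behead q).

(** As [v] is not in [H], restoring and deleting it gives [H] back, so every pair is treated from
    the same graph and the order is immaterial. *)
Lemma emits_visit n psu u (H : {set V}) (S : seq (V * seq V)) : call_spec n ->
  {in S, forall vp : V * seq V, [/\ vp.1 \notin H, path_in e (vp.1 |: H) vp.1 t vp.2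
    & forall q, path_in e (vp.1 |: H) vp.1 t q -> size q <= n]} ->
  emits (Visit psu u H S)
    (fun p => exists v q, [/\ v \in map fst S, chordless_in e (v |: H) v t q
                            & p = rcons psu v ++ behead q]).
Proof.
move=> cs; move: {2}(size S) (erefl (size S)) => m.
elim: m S => [|m IHm] S.
  move/size0nil=> -> _ k out hk; apply: inevitable_later.
    by eexists; apply: step_return.
  move=> c' /step_visitE[[_ ->]|[[|? ?] [? [? [? []]]]] //].
  by apply: hk => p; split=> [|[//|[v [q []]]]]; [left|].
move=> szS hS k out hk; apply: inevitable_later.
  case: S szS {hS hk} => // -[v pvt] S _.
  by eexists; apply: (@step_visit _ _ _ _ _ _ [::]).
move=> c' /step_visitE[[S0]|[S1 [S2 [v [pvt [SE ->]]]]]].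
  by rewrite S0 in szS.
subst S; have [] := hS (v, pvt); first by rewrite mem_cat mem_head orbT.
move=> /= vH ppvt bnd; rewrite setU1K //.
apply: (cs _ _ _ _ bnd ppvt) => out1 hout1; apply: (IHm (S1 ++ S2)).
- by move: szS; rewrite !size_cat /= addnS => -[].
- move=> vp vpS; apply: hS; move: vpS; rewrite !mem_cat inE.
  by case/orP=> ->; rewrite ?orbT.
move=> out2 hout2; apply: hk => p; rewrite hout2 hout1 map_cat.
split.
  case=> [[pout|[q [cq ->]]]|[w [q [wS cq ->]]]]; first by left.
    by right; exists v, q; split=> //; rewrite map_cat mem_cat mem_head orbT.
  right; exists w, q; split=> //; move: wS; rewrite map_cat !mem_cat inE.
  by case/orP=> ->; rewrite ?orbT.
case=> [pout|[w [q []]]]; first by left; left.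
rewrite map_cat mem_cat inE => /or3P[wS|/eqP-> cq ->|wS] *.
- by right; exists w, q; rewrite mem_cat wS.
- by left; right; exists q.
- by right; exists w, q; rewrite mem_cat wS orbT.
Qed.

(* The stored paths avoid the other neighbours of u, hence they survive the   *)
(* later deletions of the loop.                                               *)
Lemma emits_search n psu u put (H0 H : {set V}) (S : seq (V * seq V)) :
  call_spec n -> u <> t ->
  (forall q, path_in e H0 u t q -> size q <= n.+1) ->
  path_in e H u t put -> H0 = H :|: [set w in map fst S] ->
  {in S, forall vp : V * seq V, [/\ vp.1 \notin H, e u vp.1
    & path_in e (vp.1 |: [set w in H | ~~ e u w]) vp.1 t vp.2]} ->
  emits (Search psu u put H S)
    (fun p => exists q, chordless_in e H0 u t q /\ p = psu ++ behead q).
Proof.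
(* Each round deletes a vertex; [H] is never empty, as it contains [u]. *)
move=> cs nut bnd; move: {2}#|H| (leqnn #|H|) => m.
elim: m put H S => [|m IHm] put H S szH pput H0E hS k out hk.
  case/path_inP: pput => r [_ _ _ _ /(_ u)]; rewrite mem_head.
  by move: szH; rewrite leqn0 => /eqP/cards0_eq->; rewrite inE => /(_ isT).
have uH : u \in H by case/path_inP: pput => r [_ _ _ _]; apply; apply: mem_head.
(* A round preserves the invariant: beyond the closest neighbour [v], [put] meets no neighbour of
   [u]. *)
have next v pvt : closest_nbr e H u put v pvt ->
  [/\ v \in H, u \in H :\ v, H0 = H :\ v :|: [set w in map fst (rcons S (v, pvt))]
   & {in rcons S (v, pvt), forall vp : V * seq V, [/\ vp.1 \notin H :\ v, e u vp.1
    & path_in e (vp.1 |: [set w in H :\ v | ~~ e u w]) vp.1 t vp.2]}].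
  case=> r1 [r2 [putE pvtE]]; rewrite inE => /andP[vH euv] r2N; split=> //.
  - by rewrite !inE uH andbT; apply: contraTneq euv => ->; rewrite e_irr.
  - apply/setP=> w; rewrite H0E map_rcons !inE mem_rcons inE.
    by have [->|_] := eqVneq w v; rewrite ?vH.
  move=> vp; rewrite mem_rcons => /predU1P[->|/hS[vpH euvp pvp]] /=.
    split=> //; first by rewrite !inE eqxx.
    case/path_inP: pput => r [pE er lr ur rH]; apply/path_inP; exists r2.
    have ur2 : uniq (v :: r2) by move: ur; rewrite -pE putE cat_uniq => /and3P[].
    split=> //.
    + case: r1 putE => [|z r1]; rewrite pE => -[uE rE]; first by rewrite -uE -rE.
      by move: er; rewrite rE cat_path => /and3P[].
    + case: r1 putE => [|z r1]; rewrite pE => -[uE rE]; first by rewrite -lr -uE -rE.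
      by rewrite -lr rE last_cat.
    move=> w /predU1P[->|wr]; first by rewrite !inE eqxx.
    have wH : w \in H by apply: rH; rewrite -pE putE mem_cat inE [w \in r2]wr !orbT.
    have := r2N w wr; rewrite !inE wH /= => ->; rewrite !andbT.
    by rewrite orbN.
  split=> //; first by rewrite !inE negb_and vpH orbT.
  (* Deleting the neighbour [v] leaves the non-neighbours, where the older stored paths run,
     unchanged. *)
  suff -> : [set w in H :\ v | ~~ e u w] = [set w in H | ~~ e u w] by [].
  apply/setP=> w; rewrite !inE.
  by have [->|_] := eqVneq w v; rewrite ?euv ?andbF.
apply: inevitable_later.
  have [v [pvt cl]] := closest_nbr_exists nut pput.
  have [co|nco] := boolP (connected e (H :\ v) u t).
    have [put' pput'] := connected_path_in co; eexists.
    by apply: step_continue cl co pput'.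
  by eexists; apply: step_leave cl nco.
move=> c' /step_searchE[v [pvt [/next[vH uH' H0E' hS']]]].
case=> [[sep ->]|[put' [pput' ->]]].
- set H1 := H :\ v in sep uH' H0E' hS' *; set S1 := rcons S (v, pvt) in H0E' hS' *.
  have eD : {in [set w in map fst S1], forall v, e u v}.
    by move=> w; rewrite inE => /mapP[vp /hS'[_ euvp _] ->].
  apply: (emits_visit (n := n)) => //.
    move=> vp vpS; have [vpH euvp pvp] := hS' _ vpS; split=> //.
      case/path_inP: pvp => r [-> ? ? ? rH]; apply/path_inP; exists r; split=> //.
      move=> w /rH; rewrite !in_setU1 => /predU1P[->|]; first by rewrite eqxx.
      by rewrite in_set => /andP[-> _]; rewrite orbT.
    (* Prefixing [u] gives a path of [H0] with one more vertex, so the bound drops to [n]. *)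
    move=> q pq; rewrite -ltnS; apply: (bnd (u :: q)); rewrite H0E'.
    by apply: path_in_cons pq; rewrite // inE; apply: map_f.
  move=> out' hout'; apply: hk => p; rewrite hout' H0E'.
  have br := @chordless_in_branch _ _ e_sym e_irr _ _ _ _ uH' eD sep.
  split=> -[pout|]; [by left| |by left|].
    case=> w [q [wS cq ->]]; right; exists (u :: q); split.
      by apply/br; [exact/eqP|exists w, q; rewrite inE].
    by case: cq => /path_inP[r [-> _ _ _ _]] _; rewrite cat_rcons.
  case=> q [/br []]; first exact/eqP.
  move=> w [q' [wS cq ->]] ->; right; exists w, q'; rewrite inE in wS; split=> //.
  by case: cq => /path_inP[r [-> _ _ _ _]] _; rewrite cat_rcons.
- apply: (IHm _ _ _ _ pput' H0E' hS' _ _ hk).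
  by move: szH; rewrite (cardsD1 v H) vH.
Qed.

Lemma emits_call n : call_spec n.
Proof.
elim: n => [|n IHn] psu u put H bnd pput k out hk.
  (* The bound 0 is impossible, since [put] has a vertex. *)
  by have := bnd _ pput; case/path_inP: pput => r [->].
have [ut|/eqP nut] := eqVneq u t; last first.
  apply: inevitable_later; first by eexists; apply: step_start.
  move=> c' st; inversion st; subst => //.
  apply: (emits_search IHn nut bnd pput _ _ hk) => //.
  by apply/setP=> w; rewrite !inE orbF.
subst u; apply: inevitable_later; first by eexists; apply: step_output.
have tH : t \in H by case/path_inP: pput => r [_ _ _ _]; apply; apply: mem_head.
move=> c' st; inversion st; subst => //; apply: hk => p.
rewrite mem_rcons inE; split=> [/predU1P[->|pout]|[pout|]].
- right; exists [:: t]; rewrite cats0; split=> //.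
  exact/chordless_in_refl.
- by left.
- by rewrite pout orbT.
- by case=> q [/chordless_in_refl -> // ->]; rewrite cats0 eqxx.
Qed.

End Runs.

Theorem theorem1 (V : finType) (e : rel V) (e_sym : symmetric e)
    (e_irr : irreflexive e) (s t : V) (st_conn : connected e [set: V] s t)
    (pi : seq V) (pi_path : path_in e [set: V] s t pi) :
  terminates e t (initial s pi) /\
  (forall c : config V, halts_in e t (initial s pi) c ->
     exists out : seq (seq V), c = ([::], out) /\
       forall p : seq V, p \in out <-> chordless_path e s t p).
Proof.
apply: inevitable_halts => [c1 c2 [out [-> _]] st|]; first by inversion st.
(* Vertices on a path are distinct, so [#|V|] bounds its size. *)
apply: (@emits_call _ e t e_sym e_irr _ #|V|) => // [q|out' hout'].
  by case/path_inP=> r [-> _ _ /card_uniqP <- _]; apply: max_card.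
apply: inevitable_now; exists out'; split=> // p; rewrite hout'.
split=> [[//|[q [cq ->]]]|cp].
  by case: (cq) => /path_inP[r [qE _ _ _ _]] _; rewrite qE in cq *.
right; exists p; split=> //.
by case: cp => /path_inP[r [-> _ _ _ _]] _.
Qed.
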